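(* Let $p$ be a prime, let $A$ be a set with $|A|=p^2$, and let $f:A\to A$ be a bijection. Then there exists a binary operation $*$ on $A$ such that $(A,* )$ is an abelian group and $f$ is an automorphism of $(A,* )$ if and only if $f$ is the identity map or the multiset of cycle lengths of $f$ is one of the following: (a) $\frac{p^2-1}{d}$ cycles of length $d$ together with one cycle of length $1$, for some positive divisor $d$ of $p^2-1$; (b) $\frac{p-1}{d}$ cycles of length $pd$, $\frac{p-1}{d}$ cycles of length $d$, and one cycle of length $1$, for some positive divisor $d$ of $p-1$; (c) $\frac{(p-1)^2}{\mathrm{lcm}(d_1,d_2)}$ cycles of length $\mathrm{lcm}(d_1,d_2)$, $\frac{p-1}{d_1}$ cycles of length $d_1$, $\frac{p-1}{d_2}$ cycles of length $d_2$, and one cycle of length $1$, for some positive divisors $d_1,d_2$ of $p-1$ (cycles listed with equal lengths being counted together). (Equivalently: the cycle structures realised by automorphisms of any abelian group of order $p^2$ are exactly those realised by automorphisms of $\mathbb{Z}_p\times\mathbb{Z}_p$.)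
   Context: For a bijection $f$ of a finite set, a cycle is a sequence $a_1,\dots,a_m$ of distinct elements with $f(a_j)=a_{j+1}$ for $j<m$ and $f(a_m)=a_1$; its length is $m$; every element lies in exactly one cycle, and fixed points are cycles of length $1$. *)

(* Defs.v *)
From mathcomp Require Import all_boot all_fingroup.
Set Implicit Arguments. Unset Strict Implicit. Unset Printing Implicit Defensive.

Definition is_abelian_group (A : Type) (op : A -> A -> A) : Prop :=
  associative op /\ commutative op /\
  exists e : A, left_id e op /\ forall x : A, exists y : A, op y x = e.

Definition cycle_count (A : finType) (f : {perm A}) (n : nat) : nat :=
  #|[set C in porbits f | #|C| == n]|.

(* Multiset given by a list of (length, multiplicity) pairs;
   entries with equal lengths are counted together. *)
Definition ms_of (s : seq (nat * nat)) (n : nat) : nat :=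
  \sum_(e <- s) (if e.1 == n then e.2 else 0).

Definition has_cycle_type (A : finType) (f : {perm A}) (s : seq (nat * nat)) : Prop :=
  forall n, cycle_count f n = ms_of s n.

(* Main.v *)
Require Import Defs.
From HB Require Import structures.
From mathcomp Require Import all_boot all_fingroup all_algebra all_solvable all_field.
Import GRing.Theory.
Set Implicit Arguments. Unset Strict Implicit. Unset Printing Implicit Defensive.

(* Forward direction. The fixed points of a power of an automorphism f form an
   f-invariant subgroup. If all nontrivial elements have cycles of the same
   length we are in case (a). Otherwise some x <> 1 has a cycle length d with
   f^d <> 1, so P = ker phi and I = im phi, where phi(y) = f^d(y) y^-1, are
   f-invariant subgroups of order p. On the nontrivial elements of an invariant
   subgroup of prime order the cycle length is constant. If I = P, then
   f^(dj)(y) = phi(y)^j y outside P, which gives case (b); otherwise the group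
   is the direct product of P and I, which gives case (c).

   Backward direction. Permutations with equal cycle counts are conjugate by a
   bijection, along which a group operation can be transported; the cycle types
   (a), (b), (c) are those of multiplication by a root of unity in the field with
   p^2 elements, of a Jordan block and of a diagonal matrix over the prime field. *)

(** * Cycles of a permutation *)

Section Orbits.
Variables (T : finType) (f : {perm T}).

Lemma porbit_f x : porbit f (f x) = porbit f x.
Proof. by have := porbit_perm f 1 x; rewrite expg1. Qed.

(** Only the remainder of [k] modulo the cycle length matters, and a nonzero remainder fixing [x]
    would repeat an entry of the duplicate-free traject of its cycle. *)
Lemma permX_fix_dvdn k x : ((f ^+ k)%g x == x) = (#|porbit f x| %| k).
Proof.
have fixM m : (f ^+ (#|porbit f x| * m))%g x = x.
  elim: m => [|m IH]; first by rewrite muln0 perm1.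
  by rewrite mulnS expgD permM [X in (f ^+ _)%g X]permX iter_porbit.
have n_gt0 : 0 < #|porbit f x| by rewrite lt0n card_porbit_neq0.
apply/eqP/idP => [fx|/dvdnP[m ->]]; last by rewrite mulnC.
move: fx; rewrite {1}(divn_eq k #|porbit f x|) mulnC expgD permM fixM permX.
move: (ltn_pmod k n_gt0); rewrite /dvdn.
case: (k %% _) => [//|i] i_lt fx.
have := uniq_traject_porbit f x.
case En: #|porbit f x| i_lt => [//|n] i_lt /= /andP[/negP[]].
by apply/trajectP; exists i; rewrite -?iterSr.
Qed.

(** A number is determined by its multiples. Cycle lengths of explicit maps are computed in this
    way, by deciding which powers fix a point. *)
Lemma card_porbit_period n x :
  (forall k, ((f ^+ k)%g x == x) = (n %| k)) -> #|porbit f x| = n.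
Proof.
move=> fixn; apply/eqP; rewrite eqn_dvd -fixn permX_fix_dvdn dvdnn.
by rewrite -permX_fix_dvdn fixn dvdnn.
Qed.

Lemma card_porbit_imset (S : {set T}) n :
    {in S, forall x, f x \in S} -> {in S, forall x, #|porbit f x| = n} ->
  #|S| = #|porbit f @: S| * n.
Proof.
move=> fS nS; apply: card_uniform_partition => [_ /imsetP[x xS ->]|]; first exact: nS.
have sub x : x \in S -> porbit f x \subset S.
  move=> xS; apply/subsetP => _ /porbitP[i ->]; elim: i => [|i IH].
    by rewrite perm1.
  by rewrite expgSr permM fS.
apply/and3P; split.
- rewrite eqEsubset; apply/andP; split.
    by apply/bigcupsP => _ /imsetP[x xS ->]; apply: sub.
  apply/subsetP => x xS; apply/bigcupP; exists (porbit f x); first exact: imset_f.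
  exact: porbit_id.
- apply/trivIsetP => _ _ /imsetP[x xS ->] /imsetP[y yS ->]; apply: contraR.
  case/pred0Pn => z /= /andP[]; rewrite -!eq_porbit_mem => /eqP<- /eqP<-.
  exact: eqxx.
- apply/imsetP => -[x xS /setP/(_ x)]; by rewrite porbit_id inE.
Qed.

Lemma dvdn_card_porbit (S : {set T}) n :
    {in S, forall x, f x \in S} -> {in S, forall x, #|porbit f x| = n} ->
  n %| #|S|.
Proof. by move=> fS nS; rewrite (card_porbit_imset fS nS) dvdn_mull. Qed.

(** The points on cycles of length [n] form an [f]-stable set, which those cycles partition into
    blocks of size [n]. *)
Lemma cycle_count_muln n : cycle_count f n * n = #|[set x | #|porbit f x| == n]|.
Proof.
rewrite (@card_porbit_imset _ n); first last.
- by move=> x; rewrite inE => /eqP.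
- by move=> x; rewrite !inE porbit_f.
congr (#|pred_of_set _| * n); apply/setP => C; rewrite inE.
apply/andP/imsetP => [[/imsetP[x _ ->] nx]|[x]]; first by exists x; rewrite ?inE.
by rewrite inE => nx ->; rewrite imset_f.
Qed.

(* [c] sends each point to the position in [s] of the entry describing its cycle. *)
Lemma has_cycle_type_of_partition (s : seq (nat * nat)) (c : T -> nat) :
    all (fun e => 0 < e.1) s ->
    (forall x, c x < size s) ->
    (forall x, #|porbit f x| = (nth (0, 0) s (c x)).1) ->
    (forall i, i < size s ->
       #|[set x | c x == i]| = (nth (0, 0) s i).1 * (nth (0, 0) s i).2) ->
  has_cycle_type f s.
Proof.
move=> s_gt0 c_lt lenE cardE n.
have ms_ord : ms_of s n =
    \sum_(i < size s) (if (nth (0, 0) s i).1 == n then (nth (0, 0) s i).2 else 0).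
  by rewrite /ms_of (big_nth (0, 0)) big_mkord.
(* Length 0 is treated apart, because the argument for positive [n] cancels a factor [n]: no orbit
   is empty and no entry of [s] has length 0. *)
have [->|n_gt0] := posnP n.
  rewrite /cycle_count /ms_of big1_seq => [|e /andP[_ /(allP s_gt0)]]; last by case: eqP => // ->.
  apply/eqP; rewrite cards_eq0; apply/eqP/setP => C; rewrite !inE.
  by apply/andP => -[/imsetP[x _ ->]]; rewrite (negPf (card_porbit_neq0 _ _)).
apply/eqP; rewrite -(eqn_pmul2r n_gt0) cycle_count_muln ms_ord big_distrl /=.
pose c' x := Ordinal (c_lt x).
(* Sort the points by their position in [s]: an entry contributes all its points if its length is
   [n], and none otherwise. *)
rewrite -sum1_card (partition_big c' xpredT) //=; apply/eqP/eq_bigr => i _.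
have [lin|lin] := eqVneq (nth (0, 0) s i).1 n; last first.
  rewrite big1 // => x /andP[]; rewrite inE lenE => len_x /eqP ci.
  by rewrite -ci /= len_x in lin.
rewrite sum1_card mulnC -lin -cardE //; apply: eq_card => x; rewrite unfold_in /= !inE.
have -> : (c' x == i) = (c x == i) by [].
by rewrite andbC; case: eqP => //= ci; rewrite lenE ci lin eqxx.
Qed.

(** One step along a cycle, wrapping to position 0 at its end. As [f] does not occur in it, the
    codes of two permutations can be compared. *)
Definition next_code (c : nat * nat * nat) :=
  (c.1, if c.2.+1 == c.1.1 then 0 else c.2.+1).

(* The three coordinates are the length of the cycle of [x], the number of that
   cycle among those of the same length, and the position of [x] in it. *)
Lemma cycle_coding : exists code : T -> nat * nat * nat,
  [/\ injective code, forall x, code (f x) = next_code (code x) &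
      forall c, (exists x, code x = c) <->
                (c.1.2 < cycle_count f c.1.1 /\ c.2 < c.1.1)].
Proof.
pose cyc n := [set C in porbits f | #|C| == n].
(* A representative that depends only on the orbit as a set; the default [x] never occurs, since the
   orbit contains [x]. *)
pose base x := odflt x [pick y in porbit f x].
have baseP x : porbit f (base x) = porbit f x.
  rewrite /base; case: pickP => [y|/(_ x)] //=.
  by rewrite -eq_porbit_mem => /eqP.
have eq_base x y : porbit f x = porbit f y -> base x = base y.
  move=> exy; rewrite /base exy; case: pickP => [//|/(_ y)].
  by rewrite /= porbit_id.
have in_cyc x : porbit f x \in enum (cyc #|porbit f x|).
  by rewrite mem_enum inE eqxx imset_f.
pose tr x := traject f (base x) #|porbit f x|.
have uniq_tr x : uniq (tr x) by rewrite /tr -baseP uniq_traject_porbit.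
have mem_tr x : x \in tr x by rewrite /tr -baseP -porbit_traject baseP porbit_id.
have nth_tr x y i : i < #|porbit f x| -> nth y (tr x) i = (f ^+ i)%g (base x).
  move=> i_lt; rewrite (set_nth_default (base x)) ?size_traject // nth_traject //.
  by rewrite permX.
pose code x := (#|porbit f x|, index (porbit f x) (enum (cyc #|porbit f x|)),
                index x (tr x)).
exists code; split.
- move=> x y [en ec]; rewrite -en in ec => ei.
  have exy : porbit f x = porbit f y.
    by apply: (index_inj (porbit f x) (in_cyc x) _ ec); rewrite en in_cyc.
  have etr : tr x = tr y by rewrite /tr exy (eq_base _ _ exy).
  by rewrite -etr in ei; apply: (index_inj x (mem_tr x) _ ei); rewrite etr.
- move=> x; rewrite /next_code /code /= porbit_f; congr (_, _).
  have -> : tr (f x) = tr x by rewrite /tr porbit_f (eq_base _ _ (porbit_f x)).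
  have i_lt : index x (tr x) < #|porbit f x|.
    by rewrite -[X in _ < X](size_traject f (base x)) index_mem.
  have fxE : f x = (f ^+ (index x (tr x)).+1)%g (base x).
    by rewrite expgSr permM -(nth_tr _ x) ?nth_index.
  (* After the last position of the cycle, [f x] is the base point again, whose position is 0. *)
  rewrite {1}fxE; case: eqP => [e|ne].
    rewrite e -baseP permX iter_porbit -{1}[base x]perm1 -[1%g](expg0 f).
    rewrite -(nth_tr x x) ?index_uniq ?size_traject //; exact: leq_ltn_trans i_lt.
  have i1_lt : (index x (tr x)).+1 < #|porbit f x| by rewrite ltn_neqAle i_lt andbT; apply/eqP.
  by rewrite -(nth_tr x x) ?index_uniq ?size_traject.
- case=> [[n i] k] /=; split=> [[x [<- <- <-]]|[i_lt k_lt]].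
    split; last by rewrite -[X in _ < X](size_traject f (base x)) index_mem.
    by have := in_cyc x; rewrite -index_mem -cardE.
  rewrite /cycle_count cardE in i_lt.
  have := mem_nth set0 i_lt; rewrite mem_enum inE => /andP[/imsetP[x _ Ex] /eqP nE].
  have lenx : #|porbit f x| = n by rewrite -Ex.
  exists ((f ^+ k)%g (base x)).
  have eo : porbit f ((f ^+ k)%g (base x)) = porbit f x by rewrite porbit_perm.
  rewrite /code /tr eo (eq_base _ _ eo) lenx -{1}Ex index_uniq ?enum_uniq //.
  by congr (_, _); rewrite -lenx -(nth_tr x x) ?lenx // -[n]lenx index_uniq ?size_traject ?lenx.
Qed.

End Orbits.

(** The set of codes that occur depends only on the cycle counts, and [next_code] describes both
    permutations on codes. Hence matching points with equal codes gives the bijection. *)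
Lemma perm_conjugate_of_cycle_count (T U : finType) (f : {perm T}) (g : {perm U}) :
    cycle_count f =1 cycle_count g ->
  exists h : T -> U, bijective h /\ forall x, h (f x) = g (h x).
Proof.
move=> cE.
have [cf [injf nextf imf]] := cycle_coding f.
have [cg [injg nextg img]] := cycle_coding g.
have hP x : exists y, cg y == cf x.
  have [|y <-] := (img (cf x)).2; last by exists y.
  by rewrite -cE; apply/(imf (cf x)).1; exists x.
have kP y : exists x, cf x == cg y.
  have [|x <-] := (imf (cg y)).2; last by exists x.
  by rewrite cE; apply/(img (cg y)).1; exists y.
exists (fun x => xchoose (hP x)); split.
  exists (fun y => xchoose (kP y)) => [x|y].
    by apply/injf/eqP; rewrite (eqP (xchooseP (kP _))) (eqP (xchooseP (hP x))).
  by apply/injg/eqP; rewrite (eqP (xchooseP (hP _))) (eqP (xchooseP (kP y))).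
by move=> x; apply: injg; rewrite nextg !(eqP (xchooseP (hP _))).
Qed.

(** * Recognizing the three cycle types *)

Section CycleTypes.
Variables (p : nat) (T : finType) (f : {perm T}) (e : T).
Hypotheses (p_gt0 : 0 < p) (cardT : #|T| = p ^ 2) (len_e : #|porbit f e| = 1).

Lemma has_cycle_type_one_length d :
    0 < d -> d %| p ^ 2 - 1 -> (forall x, x != e -> #|porbit f x| = d) ->
  has_cycle_type f [:: (d, (p ^ 2 - 1) %/ d); (1, 1)].
Proof.
move=> d_gt0 dvd_d len_d.
apply: (@has_cycle_type_of_partition _ _ _ (fun x => (x == e) : nat)).
- by rewrite /= d_gt0.
- by move=> x; case: (x == e).
- by move=> x; case: eqVneq => [->|/len_d].
case=> [|[|//]] _ /=.
  rewrite mulnC divnK //; have := cardsC1 e; rewrite cardT subn1 => <-.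
  by apply: eq_card => x; rewrite !inE; case: (x == e).
rewrite muln1 -[RHS](cards1 e).
by apply: eq_card => x; rewrite !inE; case: (x == e).
Qed.

Lemma has_cycle_type_jordan (P : {set T}) d :
    e \in P -> #|P| = p -> 0 < d -> d %| p - 1 ->
    (forall x, x \in P -> x != e -> #|porbit f x| = d) ->
    (forall x, x \notin P -> #|porbit f x| = p * d) ->
  has_cycle_type f [:: (p * d, (p - 1) %/ d); (d, (p - 1) %/ d); (1, 1)].
Proof.
move=> eP cardP d_gt0 dvd_d lenP lenP'.
apply: (@has_cycle_type_of_partition _ _ _
  (fun x => if x == e then 2 else if x \in P then 1 else 0)).
- by rewrite /= muln_gt0 p_gt0 d_gt0.
- by move=> x; case: (x == e); case: (x \in P).
- by move=> x /=; case: eqVneq => [->//|ne]; case: ifP => [/lenP->|/negbT/lenP'->].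
case=> [|[|[|//]]] _ /=.
- rewrite -mulnA [d * _]mulnC divnK // mulnBr muln1.
  have := cardsC P; rewrite cardP cardT => cC.
  rewrite -[p * p]cC addKn; apply: eq_card => x; rewrite !inE.
  by case: (eqVneq x e) => [->|_]; [rewrite eP | case: (x \in P)].
- rewrite mulnC divnK //; have := cardsD1 e P; rewrite eP cardP => ->.
  by rewrite addKn; apply: eq_card => x; rewrite !inE; case: (x == e) => //; case: (x \in P).
rewrite muln1 -[RHS](cards1 e); apply: eq_card => x; rewrite !inE.
by case: (x == e) => //; case: (x \in P).
Qed.

Lemma has_cycle_type_diagonal (P Q : {set T}) d1 d2 :
    P :&: Q = [set e] -> #|P| = p -> #|Q| = p ->
    0 < d1 -> 0 < d2 -> d1 %| p - 1 -> d2 %| p - 1 ->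
    (forall x, x \in P -> x != e -> #|porbit f x| = d1) ->
    (forall x, x \in Q -> x != e -> #|porbit f x| = d2) ->
    (forall x, x \notin P -> x \notin Q -> #|porbit f x| = lcmn d1 d2) ->
  has_cycle_type f [:: (lcmn d1 d2, (p - 1) ^ 2 %/ lcmn d1 d2);
                       (d1, (p - 1) %/ d1); (d2, (p - 1) %/ d2); (1, 1)].
Proof.
move=> PQ cardP cardQ d1_gt0 d2_gt0 dvd_d1 dvd_d2 lenP lenQ lenPQ.
have /andP[eP eQ] : (e \in P) && (e \in Q) by rewrite -in_setI PQ set11.
have PQe x : x \in P -> x \in Q -> x = e.
  by move=> xP xQ; apply/set1P; rewrite -PQ inE xP.
apply: (@has_cycle_type_of_partition _ _ _
  (fun x => if x == e then 3 else if x \in P then 1 else if x \in Q then 2 else 0)).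
- by rewrite /= lcmn_gt0 d1_gt0 d2_gt0.
- by move=> x; case: (x == e); case: (x \in P); case: (x \in Q).
- move=> x /=; case: eqVneq => [->//|ne]; case: ifP => [/lenP->//|/negbT xP].
  by case: ifP => [/lenQ->|/negbT/(lenPQ _ xP)->].
case=> [|[|[|[|//]]]] _ /=.
- rewrite mulnC divnK ?dvdn_exp // ?dvdn_lcm ?dvd_d1 ?dvd_d2 //.
  have := cardsC (P :|: Q); rewrite cardsU PQ cardP cardQ cards1 cardT => cC.
  (* The subtracted number is the size of the union of [P] and [Q], which share only [e]. *)
  have -> : (p - 1) ^ 2 = p ^ 2 - (p + p - 1).
    by case: (p) p_gt0 => // q _; rewrite -!mulnn mulSn mulnS addnA addnS !subn1 addKn.
  rewrite -cC addKn; apply: eq_card => x; rewrite !inE.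
  by case: (eqVneq x e) => [->|_]; [rewrite eP | case: (x \in P); case: (x \in Q)].
- rewrite mulnC divnK //; have := cardsD1 e P; rewrite eP cardP => ->.
  rewrite addKn; apply: eq_card => x; rewrite !inE.
  by case: (x == e) => //; case: (x \in P); case: (x \in Q).
- rewrite mulnC divnK //; have := cardsD1 e Q; rewrite eQ cardQ => ->.
  rewrite addKn; apply: eq_card => x; rewrite !inE.
  case: (eqVneq x e) => // ne; case: (boolP (x \in P)) => [xP|_]; last by case: (x \in Q).
  by apply/esym/negbTE/negP => xQ; case/eqP: ne; apply: PQe.
rewrite muln1 -[RHS](cards1 e); apply: eq_card => x; rewrite !inE.
by case: (x == e) => //; case: (x \in P); case: (x \in Q).
Qed.

End CycleTypes.

(** * Automorphisms of abelian groups of order p^2 *)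

Section AbelianAutomorphism.
Local Open Scope group_scope.
Variables (gT : finGroupType) (f : {perm gT}).
Hypotheses (mulC : commutative (@mulg gT)) (fM : {morph f : x y / x * y}).

Lemma permX_morph k : {morph f ^+ k : x y / x * y}.
Proof. by elim: k => [|k IH] x y; rewrite ?expg0 ?perm1 // expgSr !permM IH fM. Qed.

Lemma permX_morph1 k : (f ^+ k) 1 = 1.
Proof. by apply: (mulgI ((f ^+ k) 1)); rewrite -permX_morph !mulg1. Qed.

Lemma perm_morph1 : f 1 = 1.
Proof. by have := permX_morph1 1; rewrite expg1. Qed.

Definition fixed_points k : {set gT} := [set x | (f ^+ k) x == x].

Lemma fixed_points_group_set k : group_set (fixed_points k).
Proof.
apply/group_setP; split=> [|x y]; rewrite !inE ?permX_morph1 // permX_morph.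
by move=> /eqP-> /eqP->.
Qed.
Canonical fixed_points_group k := Group (fixed_points_group_set k).

(** In additive notation this is the endomorphism f^k - 1, with kernel [fixed_points k]. *)
Definition displacement k x := (f ^+ k) x * x^-1.

Lemma displacement_morph k : {in [set: gT] &, {morph displacement k : x y / x * y}}.
Proof.
move=> x y _ _; rewrite /displacement permX_morph invMg -!mulgA; congr (_ * _).
by rewrite mulgA mulC.
Qed.
Canonical displacement_morphism k := Morphism (@displacement_morph k).

Lemma permX_displacement k x : (f ^+ k) x = displacement k x * x.
Proof. by rewrite mulgKV. Qed.

Lemma displacement_commute k i x :
  (f ^+ i) (displacement k x) = displacement k ((f ^+ i) x).
Proof.
apply: (mulIg ((f ^+ i) x)); rewrite -permX_morph -!permX_displacement -!permM.
by rewrite -!expgD addnC.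
Qed.

Lemma ker_displacement k : 'ker (displacement k) = fixed_points k.
Proof. by apply/setP => x; rewrite !inE /= -eq_mulgV1. Qed.

Lemma card_porbit1 : #|porbit f 1| = 1%N.
Proof. by apply: card_porbit_period => k; rewrite permX_morph1 eqxx dvd1n. Qed.

(** A power of [f] fixing one nontrivial element of [H] fixes all of [H], because its fixed points
    form a subgroup and [H] has prime order. So the cycle lengths of any two nontrivial elements
    divide each other. *)
Lemma prime_invariant_subgroup_length (H : {group gT}) :
    prime #|H| -> {in H, forall x, f x \in H} ->
  exists d, [/\ (0 < d)%N, d %| #|H| - 1 &
                {in H, forall x, x != 1 -> #|porbit f x| = d}].
Proof.
move=> prH fH; have [x xH ne1] : exists2 x, x \in H & x != 1.
  by apply/trivgPn; rewrite trivg_card1 neq_ltn prime_gt1 ?orbT.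
have dvdl y z : y \in H -> z \in H -> y != 1 -> #|porbit f z| %| #|porbit f y|.
  move=> yH zH ney; rewrite -permX_fix_dvdn.
  have /subsetP/(_ z zH) : H \subset fixed_points #|porbit f y|; last by rewrite inE.
  apply: prime_meetG => //; apply/trivgPn; exists y => //.
  by rewrite !inE yH permX_fix_dvdn dvdnn.
have lenH y : y \in H -> y != 1 -> #|porbit f y| = #|porbit f x|.
  by move=> yH ney; apply/eqP; rewrite eqn_dvd !dvdl.
exists #|porbit f x|; split => //; first by rewrite lt0n card_porbit_neq0.
have -> : (#|H| - 1)%N = #|H :\ 1| by rewrite (cardsD1 1 H) group1 addKn.
apply: (dvdn_card_porbit (f := f)).
  move=> y; rewrite !inE => /andP[ney yH]; rewrite fH // andbT.
  by rewrite -perm_morph1 (inj_eq perm_inj).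
by move=> y; rewrite !inE => /andP[ney yH]; apply: lenH.
Qed.

(** The identity (1 + N)^j = 1 + jN for N = f^k - 1, at a point that N^2 sends to the neutral
    element. *)
Lemma permX_displacement_iter k j y :
    displacement k y \in fixed_points k ->
  (f ^+ (k * j)) y = displacement k y ^+ j * y.
Proof.
move=> zP; elim: j => [|j IH]; first by rewrite muln0 perm1 mul1g.
rewrite mulnS addnC expgD permM IH permX_morph [(f ^+ k) y]permX_displacement.
by have := groupX j zP; rewrite inE => /eqP->; rewrite mulgA -expgSr.
Qed.

Theorem cycle_type_of_abelian_automorphism p :
    prime p -> #|gT| = (p ^ 2)%N ->
  ((exists d, 0 < d /\ d %| p ^ 2 - 1 /\
     has_cycle_type f [:: (d, (p ^ 2 - 1) %/ d); (1, 1)]) \/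
  (exists d, 0 < d /\ d %| p - 1 /\
     has_cycle_type f [:: (p * d, (p - 1) %/ d); (d, (p - 1) %/ d); (1, 1)]) \/
  (exists d1 d2, 0 < d1 /\ 0 < d2 /\ d1 %| p - 1 /\ d2 %| p - 1 /\
     has_cycle_type f [:: (lcmn d1 d2, (p - 1) ^ 2 %/ lcmn d1 d2);
                          (d1, (p - 1) %/ d1); (d2, (p - 1) %/ d2); (1, 1)]))%N.
Proof.
move=> prp cardG.
have p_gt0 := prime_gt0 prp; have p_gt1 := prime_gt1 prp.
have len_gt0 x : (0 < #|porbit f x|)%N by rewrite lt0n card_porbit_neq0.
have [/existsP[x /andP[nex nfx]]|/existsPn allf] :=
    boolP [exists x, (x != 1) && (f ^+ #|porbit f x| != 1)]; last first.
  left; have [x _ ne1] : exists2 x, x \in [set: gT] & x != 1.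
    by apply/trivgPn; rewrite trivg_card1 cardsT cardG neq_ltn (@ltn_exp2l p 0) ?orbT.
  (* Here the power of [f] given by the length of any nontrivial cycle is the identity, so all these
     lengths divide each other. *)
  have lenE y : y != 1 -> #|porbit f y| = #|porbit f x|.
    move=> ney; apply/eqP; rewrite eqn_dvd -!permX_fix_dvdn.
    have := allf x; rewrite ne1 negbK => /eqP->.
    by have := allf y; rewrite ney negbK => /eqP->; rewrite !perm1 !eqxx.
  have dvd_x : #|porbit f x| %| p ^ 2 - 1.
    have -> : (p ^ 2 - 1)%N = #|[set~ 1 : gT]| by rewrite cardsC1 cardG subn1.
    apply: (dvdn_card_porbit (f := f)).
      move=> y; rewrite !inE; by rewrite -[X in f y == X]perm_morph1 (inj_eq perm_inj).
    by move=> y; rewrite !inE; apply: lenE.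
  exists #|porbit f x|; do 2!split => //.
  exact: (has_cycle_type_one_length cardG card_porbit1).
right; set d := #|porbit f x| in nfx.
pose P := fixed_points_group d.
pose I := [group of displacement d @* [set: gT]].
have xP : x \in P by rewrite inE permX_fix_dvdn.
(* The order of [P] divides p^2; it is not 1, as [x] lies in [P], and not p^2, as f^d is not the
   identity. *)
have cardP : #|P| = p.
  have [m le_m Em] : exists2 m, (m <= 2)%N & #|P| = (p ^ m)%N.
    by apply/dvdn_pfactor; rewrite // -cardG -cardsT cardSg ?subsetT.
  case: m le_m Em => [|[|[|//]]] _ Em; rewrite Em ?expn1 //.
    by have /card1_trivg P1 := Em; rewrite P1 inE (negPf nex) in xP.
  case/eqP: nfx; apply/permP => y; rewrite perm1; apply/eqP.
  have : y \in P; last by rewrite inE.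
  have /eqP-> : P == [set: gT] :> {set gT}; last by rewrite inE.
  by rewrite eqEcard subsetT cardsT cardG Em /=.
(* [P] is the kernel of the displacement and [I] its image, so their orders multiply to p^2. *)
have cardI : #|I| = p.
  rewrite /= card_morphim setIid ker_displacement.
  apply/eqP; rewrite -(eqn_pmul2l p_gt0) -{1}cardP Lagrange ?subsetT //.
  by rewrite cardsT cardG.
have prP : prime #|P| by rewrite cardP.
have prI : prime #|I| by rewrite cardI.
have [d1 [d1_gt0 dvd_d1 lenP]] : exists d1, [/\ (0 < d1)%N, d1 %| #|P| - 1 &
    {in P, forall y, y != 1 -> #|porbit f y| = d1}].
  apply: prime_invariant_subgroup_length => // y; rewrite !inE => /eqP fy.
  by rewrite -permM -expgS expgSr permM fy.
have [d2 [d2_gt0 dvd_d2 lenI]] : exists d2, [/\ (0 < d2)%N, d2 %| #|I| - 1 &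
    {in I, forall y, y != 1 -> #|porbit f y| = d2}].
  apply: prime_invariant_subgroup_length => // _ /morphimP[y _ _ ->] /=.
  have := displacement_commute d 1 y; rewrite expg1 => ->.
  by apply/morphimP; exists (f y); rewrite ?inE.
(* [x] is itself a nontrivial element of [P], so its cycle length is the common one. *)
have dE : d = d1 by apply: lenP.
have displ_neq1 y : y \notin P -> displacement d y != 1.
  by rewrite inE -eq_mulgV1.
have displ_I y : displacement d y \in I by apply/morphimP; exists y; rewrite ?inE.
rewrite cardP in dvd_d1; rewrite cardI in dvd_d2.
have [sIP|nsIP] := boolP (I \subset P).
  left; exists d1; do 2!split => //.
  apply: (has_cycle_type_jordan p_gt0 cardG card_porbit1 (group1 P)) => // y yP.
  have zI := displ_I y; have nz := displ_neq1 y yP.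
  set z := displacement d y in zI nz; have zP := subsetP sIP z zI.
  have ordz : #[z] = p.
    by apply: nt_prime_order; rewrite // -cardP expg_cardG.
  (* A power fixing [y] also fixes [z], so its exponent is [d1 * j] for some [j]; it then multiplies
     [y] by [z ^+ j], which forces [p] to divide [j]. *)
  apply: card_porbit_period => k; apply/idP/idP.
    move=> /eqP fy; have /dvdnP[j kE] : d1 %| k.
      rewrite -(lenP z) // -permX_fix_dvdn displacement_commute fy //.
    move/eqP: fy; rewrite kE mulnC -dE permX_displacement_iter //.
    rewrite -[X in _ == X]mul1g (can_eq (mulgK y)) -order_dvdn ordz.
    by rewrite [(p * d)%N]mulnC dvdn_pmul2l ?len_gt0.
  case/dvdnP=> i ->; rewrite -dE mulnA mulnC [(i * p)%N]mulnC.
  by rewrite permX_displacement_iter // expgM -/z -ordz expg_order expg1n mul1g.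
right; exists d1, d2; do 4!split => //.
have tiPI : P :&: I = 1 by rewrite setIC prime_TIg.
have PI : P * I = [set: gT].
  apply/eqP; rewrite eqEcard subsetT cardsT cardG.
  by rewrite (TI_cardMg tiPI) cardP cardI mulnn leqnn.
apply: (has_cycle_type_diagonal p_gt0 cardG card_porbit1 tiPI) => // y yP yI.
have /mulsgP[a b aP bI yE] : y \in P * I by rewrite PI inE.
have nea : a != 1 by apply: contraNneq yI => a1; rewrite yE a1 mul1g.
have neb : b != 1 by apply: contraNneq yP => b1; rewrite yE b1 mulg1.
have fP k : (f ^+ k) a \in P.
  have: (f ^+ d) a = a by apply/eqP; rewrite inE in aP.
  by move=> fa; rewrite inE -permM -expgD addnC expgD permM fa.
have fI k : (f ^+ k) b \in I.
  by case/morphimP: bI => c _ _ ->; rewrite displacement_commute displ_I.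
apply: card_porbit_period => k; rewrite dvdn_lcm -(lenP a) // -(lenI b) //.
rewrite -!permX_fix_dvdn yE permX_morph; apply/eqP/andP => [fab|[/eqP-> /eqP->]//].
(* If f^k fixes the product [a * b], the change in [a] is compensated by that in [b]; it lies in
   both [P] and [I], hence is trivial. *)
have : a^-1 * (f ^+ k) a \in P :&: I.
  rewrite inE groupM ?groupV //=.
  have -> : a^-1 * (f ^+ k) a = b * ((f ^+ k) b)^-1.
    by apply: (mulgI a); apply: (mulIg ((f ^+ k) b)); rewrite mulKVg fab -!mulgA mulVg mulg1.
  by rewrite groupM ?groupV.
rewrite tiPI inE -eq_mulVg1 => /eqP fa.
by rewrite -fa in fab *; split => //; apply/eqP/(mulgI a).
Qed.

End AbelianAutomorphism.

(** * Realizing the cycle types *)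

Lemma is_abelian_group_add (V : zmodType) : is_abelian_group (@GRing.add V).
Proof.
split; first exact: addrA; split; first exact: addrC.
by exists 0%R; split=> [|x]; [exact: add0r | exists (- x)%R; rewrite addNr].
Qed.

(** The operation is pulled back along a bijection conjugating [f] to [g], so that the bijection
    becomes an isomorphism. *)
Lemma automorphism_transport (T U : finType) (f : {perm T}) (g : {perm U})
    (op : U -> U -> U) :
    is_abelian_group op -> (forall x y, g (op x y) = op (g x) (g y)) ->
    cycle_count f =1 cycle_count g ->
  exists op' : T -> T -> T, is_abelian_group op' /\
    forall x y, f (op' x y) = op' (f x) (f y).
Proof.
move=> [opA [opC [e [op1 opV]]]] gM /perm_conjugate_of_cycle_count[h [[h' hK h'K] hf]].
exists (fun x y => h' (op (h x) (h y))); split; last first.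
  by move=> x y; apply: (can_inj hK); rewrite !hf !h'K gM.
split; first by move=> x y z; rewrite !h'K opA.
split; first by move=> x y; rewrite opC.
exists (h' e); split=> [x|x]; first by rewrite h'K op1 hK.
by have [y yx] := opV (h x); exists (h' y); rewrite h'K yx.
Qed.

(** * A bare operation as a finite group structure *)

Section AbstractGroup.
Variables (T : finType) (op : T -> T -> T) (e : T) (inv : T -> T).
Hypotheses (opA : associative op) (op1 : left_id e op) (opV : left_inverse e inv op).

(** A copy of [T] whose body mentions the group laws, so that they stay parameters of the type and
    the group instance can be recovered from it. *)
Definition group_of_op : Type := let _ := (opA, op1, opV) in T.
HB.instance Definition _ := Finite.on group_of_op.
HB.instance Definition _ := Finite_isGroup.Build group_of_op opA op1 opV.

End AbstractGroup.

Lemma cycle_type_of_automorphism (T : finType) (f : {perm T}) (op : T -> T -> T) p :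
    is_abelian_group op -> (forall x y, f (op x y) = op (f x) (f y)) ->
    prime p -> #|T| = p ^ 2 ->
  (exists d, 0 < d /\ d %| p ^ 2 - 1 /\
     has_cycle_type f [:: (d, (p ^ 2 - 1) %/ d); (1, 1)]) \/
  (exists d, 0 < d /\ d %| p - 1 /\
     has_cycle_type f [:: (p * d, (p - 1) %/ d); (d, (p - 1) %/ d); (1, 1)]) \/
  (exists d1 d2, 0 < d1 /\ 0 < d2 /\ d1 %| p - 1 /\ d2 %| p - 1 /\
     has_cycle_type f [:: (lcmn d1 d2, (p - 1) ^ 2 %/ lcmn d1 d2);
                          (d1, (p - 1) %/ d1); (d2, (p - 1) %/ d2); (1, 1)]).
Proof.
(* Only for a constructor-headed [T] is the finite structure underlying
   [group_of_op] convertible to [T]. *)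
case: T f op => T structT f op [opA [opC [e [op1 opV]]]] fM prp cardT.
(* Inverses are only known to exist; the boolean equation allows [xchoose] to turn them into a
   function. *)
have exV x : exists y, op y x == e by have [y /eqP] := opV x; exists y.
have invP : left_inverse e (fun x => xchoose (exV x)) op.
  by move=> x; apply/eqP/(xchooseP (exV x)).
exact: (@cycle_type_of_abelian_automorphism (group_of_op opA op1 invP) f opC fM p).
Qed.

(** * Linear models over finite fields *)

Section Models.
Local Open Scope ring_scope.

(** The nonzero elements are [#|F| - 1] distinct roots of unity, so one of them is a primitive root
    of that order; a suitable power of it has order [d]. *)
Lemma finField_prim_root (F : finFieldType) d :
  (d %| #|F| - 1)%N -> exists a : F, d.-primitive_root a.
Proof.
move=> dvd_d.
have F_gt1 := finNzRing_gt1 F.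
have n_gt0 : (0 < #|F| - 1)%N by rewrite subn_gt0.
have /hasP[z _ prz] : has (#|F| - 1).-primitive_root (enum [set~ (0 : F)]).
  apply: has_prim_root; rewrite ?enum_uniq // -?cardE ?cardsC1 ?subn1 //.
  apply/allP => x; rewrite mem_enum !inE => nx; apply/unity_rootP.
  apply: (mulfI nx); rewrite -exprS prednK ?mulr1 ?expf_card //; exact: ltnW.
by exists (z ^+ ((#|F| - 1) %/ d)); apply: dvdn_prim_root.
Qed.

Lemma prim_root_neq0 (F : fieldType) d (a : F) : d.-primitive_root a -> a != 0.
Proof.
move=> pra; apply: contraTneq (oner_neq0 F) => a0.
by rewrite -(prim_expr_order pra) a0 expr0n gtn_eqF ?(prim_order_gt0 pra) // eqxx.
Qed.

Lemma prim_root_fix (F : fieldType) d (a x : F) :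
  d.-primitive_root a -> x != 0 -> forall k, (a ^+ k * x == x) = (d %| k)%N.
Proof.
by move=> pra nx k; rewrite (prim_order_dvd pra) -{2}[x]mul1r (inj_eq (mulIf nx)).
Qed.

Lemma one_length_model p d : prime p -> (d %| p ^ 2 - 1)%N ->
  exists (T : finType) (op : T -> T -> T) (g : {perm T}),
    [/\ is_abelian_group op, forall x y, g (op x y) = op (g x) (g y) &
    has_cycle_type g [:: (d, (p ^ 2 - 1) %/ d); (1, 1)]%N].
Proof.
move=> prp dvd_d; have [F _ cardF] := pPrimePowerField prp (isT : (0 < 2)%N).
rewrite -cardF in dvd_d; have [a pra] := finField_prim_root dvd_d.
have na := prim_root_neq0 pra.
pose g := perm (mulfI na); exists F, +%R, g; split; first exact: is_abelian_group_add.
  by move=> x y; rewrite !permE mulrDr.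
have gX k x : (g ^+ k)%g x = a ^+ k * x.
  by elim: k => [|k IH]; rewrite ?perm1 ?mul1r // expgSr permM IH permE exprS mulrA.
rewrite cardF in dvd_d.
apply: (@has_cycle_type_one_length _ _ _ 0) => //.
- by apply: card_porbit_period => k; rewrite gX mulr0 eqxx dvd1n.
- exact: prim_order_gt0 pra.
- by move=> x nx; apply: card_porbit_period => k; rewrite gX (prim_root_fix pra).
Qed.

Lemma card_axis1 (F : finFieldType) : #|[set v : F * F | v.2 == 0]| = #|F|.
Proof.
rewrite -(card_imset predT (f := fun x => (x, 0 : F))); last by move=> x y [].
apply: eq_card => -[x y]; rewrite !inE.
by apply/eqP/imsetP => [/= ->|[z _ [_ ->]]//]; exists x.
Qed.

Lemma card_axis2 (F : finFieldType) : #|[set v : F * F | v.1 == 0]| = #|F|.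
Proof.
rewrite -(card_imset predT (f := fun x => (0 : F, x))); last by move=> x y [].
apply: eq_card => -[x y]; rewrite !inE.
by apply/eqP/imsetP => [/= ->|[z _ [-> _]]//]; exists y.
Qed.

Lemma jordan_model p d : prime p -> (d %| p - 1)%N ->
  exists (T : finType) (op : T -> T -> T) (g : {perm T}),
    [/\ is_abelian_group op, forall x y, g (op x y) = op (g x) (g y) &
    has_cycle_type g [:: (p * d, (p - 1) %/ d); (d, (p - 1) %/ d); (1, 1)]%N].
Proof.
move=> prp dvd_d.
have [F chF] := pPrimePowerField prp (isT : (0 < 1)%N); rewrite expn1 => cardF.
have [|a pra] := @finField_prim_root F d; first by rewrite cardF.
have na := prim_root_neq0 pra.
(* The scalar [a] times a unipotent shear; the shear has order [p] and commutes with the scalar. *)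
pose g0 (v : F * F) := (a * v.1, a * (v.2 + v.1)).
have g_inj : injective g0.
  case=> x y [x' y']; rewrite /g0 /= => -[/(mulfI na) ex /(mulfI na)].
  by rewrite ex => /addIr->.
pose g := perm g_inj; exists (F * F)%type, +%R, g; split; first exact: is_abelian_group_add.
  by move=> u v; rewrite !permE /g0 /= !mulrDr addrACA.
have gX k v : (g ^+ k)%g v = (a ^+ k * v.1, a ^+ k * (v.2 + v.1 *+ k)).
  elim: k => [|k IH]; first by case: v => x y; rewrite perm1 !mul1r addr0.
  by rewrite expgSr permM IH permE /g0 /= -mulrDr !mulrA -!exprS -addrA -mulrSr.
have d_gt0 := prim_order_gt0 pra.
apply: (@has_cycle_type_jordan _ _ _ (0, 0) _ _ _ [set v | v.1 == 0]) => //.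
- exact: prime_gt0.
- by rewrite card_prod cardF mulnn.
- by apply: card_porbit_period => k; rewrite gX /= mul0rn addr0 !mulr0 eqxx dvd1n.
- by rewrite inE.
- by rewrite card_axis2.
- case=> x y; rewrite inE /= => /eqP->; rewrite -pair_eqE /= eqxx /= => ny.
  apply: card_porbit_period => k; rewrite gX /= mul0rn addr0 mulr0.
  by rewrite -pair_eqE /= eqxx (prim_root_fix pra).
case=> x y; rewrite inE /= => nx; apply: card_porbit_period => k.
(* As [d] is at most p - 1, it is coprime to [p], so divisibility by [p * d] splits into two
   conditions. *)
rewrite gX -pair_eqE /= (prim_root_fix pra) // Gauss_dvd; last first.
  rewrite prime_coprime //; apply/negP => /(dvdn_leq d_gt0); rewrite leqNgt => /negP[].
  by rewrite (leq_ltn_trans (dvdn_leq _ dvd_d)) ?subn_gt0 ?prime_gt1 // subn1 ltn_predL prime_gt0.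
(* Once [a ^+ k = 1], the second coordinate is fixed exactly when [x *+ k = 0], that is, when the
   characteristic [p] divides [k]. *)
rewrite andbC (prim_order_dvd pra); case: (eqVneq (a ^+ k) 1) => [->|]; last by rewrite !andbF.
rewrite mul1r !andbT -{2}[y]addr0 (inj_eq (addrI y)) -mulr_natr mulf_eq0 (negPf nx) /=.
by rewrite (dvdn_pcharf chF).
Qed.

Lemma diagonal_model p d1 d2 : prime p -> (d1 %| p - 1)%N -> (d2 %| p - 1)%N ->
  exists (T : finType) (op : T -> T -> T) (g : {perm T}),
    [/\ is_abelian_group op, forall x y, g (op x y) = op (g x) (g y) &
    has_cycle_type g [:: (lcmn d1 d2, (p - 1) ^ 2 %/ lcmn d1 d2);
                         (d1, (p - 1) %/ d1); (d2, (p - 1) %/ d2); (1, 1)]%N].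
Proof.
move=> prp dvd_d1 dvd_d2.
have [F _] := pPrimePowerField prp (isT : (0 < 1)%N); rewrite expn1 => cardF.
have [|a pra] := @finField_prim_root F d1; first by rewrite cardF.
have [|b prb] := @finField_prim_root F d2; first by rewrite cardF.
have na := prim_root_neq0 pra; have nb := prim_root_neq0 prb.
pose g0 (v : F * F) := (a * v.1, b * v.2).
have g_inj : injective g0.
  by case=> x y [x' y']; rewrite /g0 /= => -[/(mulfI na) -> /(mulfI nb) ->].
pose g := perm g_inj; exists (F * F)%type, +%R, g; split; first exact: is_abelian_group_add.
  by move=> u v; rewrite !permE /g0 /= !mulrDr.
have gX k v : (g ^+ k)%g v = (a ^+ k * v.1, b ^+ k * v.2).
  elim: k => [|k IH]; first by case: v => x y; rewrite perm1 !mul1r.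
  by rewrite expgSr permM IH permE /g0 /= !mulrA -!exprS.
(* The two axes are the eigenlines for [a] and [b]; off both axes a power fixes a point only if it
   fixes each coordinate. *)
apply: (@has_cycle_type_diagonal _ _ _ (0, 0) _ _ _
          [set v | v.2 == 0] [set v | v.1 == 0]) => //.
- exact: prime_gt0.
- by rewrite card_prod cardF mulnn.
- by apply: card_porbit_period => k; rewrite gX !mulr0 eqxx dvd1n.
- by apply/setP => -[x y]; rewrite !inE -pair_eqE /= andbC.
- by rewrite card_axis1.
- by rewrite card_axis2.
- exact: prim_order_gt0 pra.
- exact: prim_order_gt0 prb.
- case=> x y; rewrite inE /= => /eqP->; rewrite -pair_eqE /= eqxx andbT => nx.
  apply: card_porbit_period => k; rewrite gX /= mulr0.
  by rewrite -pair_eqE /= eqxx andbT (prim_root_fix pra).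
- case=> x y; rewrite inE /= => /eqP->; rewrite -pair_eqE /= eqxx /= => ny.
  apply: card_porbit_period => k; rewrite gX /= mulr0.
  by rewrite -pair_eqE /= eqxx (prim_root_fix prb).
case=> x y; rewrite !inE /= => ny nx; apply: card_porbit_period => k.
by rewrite gX -pair_eqE /= (prim_root_fix pra) // (prim_root_fix prb) // dvdn_lcm.
Qed.

End Models.

(** The identity is the instance d = 1 of type (a), so the model for (a) serves for it as well. *)
Lemma has_cycle_type_identity p (T : finType) : prime p -> #|T| = p ^ 2 ->
  has_cycle_type (1%g : {perm T}) [:: (1, (p ^ 2 - 1) %/ 1); (1, 1)].
Proof.
move=> prp cardT.
have len1 x : #|porbit (1%g : {perm T}) x| = 1.
  by apply: card_porbit_period => k; rewrite expg1n perm1 eqxx dvd1n.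
have /card_gt0P[e _] : 0 < #|T| by rewrite cardT expn_gt0 prime_gt0.
by apply: (has_cycle_type_one_length cardT (len1 e)) => //; rewrite dvd1n.
Qed.

Theorem theorem2p7 (p : nat) (A : finType) (f : {perm A}) :
  prime p -> #|A| = p ^ 2 ->
  (exists op : A -> A -> A, is_abelian_group op /\
      forall x y, f (op x y) = op (f x) (f y))
  <->
  (f = 1%g \/
   (exists d, 0 < d /\ d %| p ^ 2 - 1 /\
      has_cycle_type f [:: (d, (p ^ 2 - 1) %/ d); (1, 1)]) \/
   (exists d, 0 < d /\ d %| p - 1 /\
      has_cycle_type f [:: (p * d, (p - 1) %/ d); (d, (p - 1) %/ d); (1, 1)]) \/
   (exists d1 d2, 0 < d1 /\ 0 < d2 /\ d1 %| p - 1 /\ d2 %| p - 1 /\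
      has_cycle_type f [:: (lcmn d1 d2, (p - 1) ^ 2 %/ lcmn d1 d2);
                           (d1, (p - 1) %/ d1); (d2, (p - 1) %/ d2); (1, 1)])).
Proof.
move=> prp cardA; split=> [[op [opG fM]]|cycles].
  by right; apply: (cycle_type_of_automorphism opG fM).
(* Realizability depends only on the cycle type, so one model of each type suffices. *)
have transfer s : has_cycle_type f s ->
    (exists (T : finType) (op : T -> T -> T) (g : {perm T}),
       [/\ is_abelian_group op, forall x y, g (op x y) = op (g x) (g y) &
           has_cycle_type g s]) ->
  exists op : A -> A -> A, is_abelian_group op /\
      forall x y, f (op x y) = op (f x) (f y).
  move=> fs [T [op [g [opG gM gs]]]].
  by apply: (automorphism_transport opG gM) => n; rewrite fs gs.
case: cycles => [f1|[[d [_ [dvd_d fs]]]|[[d [_ [dvd_d fs]]]|]]].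
- rewrite f1 in transfer *; apply: transfer (has_cycle_type_identity prp cardA) _.
  by apply: one_length_model; rewrite ?dvd1n.
- exact: transfer fs (one_length_model prp dvd_d).
- exact: transfer fs (jordan_model prp dvd_d).
case=> d1 [d2 [_ [_ [dvd_d1 [dvd_d2 fs]]]]].
exact: transfer fs (diagonal_model prp dvd_d1 dvd_d2).
Qed.
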